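(* Let $P$ be a projection algebra. Then its chain semigroup $\mathsf{PG}(P)$ is a projection-generated (equivalently, idempotent-generated) regular $*$-semigroup whose projection algebra is precisely $P$; that is, $\mathbf P(\mathsf{PG}(P))=P$ as projection algebras, where each $p\in P$ is identified with the reduced chain $[\![p]\!]\in\mathsf{PG}(P)$.
   Context: Maps are written to the right of their arguments and composed left to right. A regular $*$-semigroup is a semigroup $S$ with a unary operation $a\mapsto a^*$ satisfying $(a^* )^*=a=aa^*a$ and $(ab)^*=b^*a^*$ for all $a,b\in S$. Its set of projections is $\mathbf P(S)=\{p\in S: p^2=p=p^*\}$. It is projection-generated (idempotent-generated) if it is generated as a semigroup by its projections (idempotents). A projection algebra is a set $P$ with unary operations $\theta_p:P\to P$ ($p\in P$) such that for all $p,q\in P$: $p\theta_p=p$; $\theta_p\theta_p=\theta_p$; $p\theta_q\theta_p=q\theta_p$; $\theta_p\theta_q\theta_p=\theta_{q\theta_p}$; $\theta_p\theta_q\theta_p\theta_q=\theta_p\theta_q$. For a regular $*$-semigroup $S$, $\mathbf P(S)$ is a projection algebra with $q\theta_p=pqp$. On a projection algebra $P$ define: $p\leq_{\mathscr F}q$ iff $p=q\theta_p$; and $p\mathrel{\mathscr F}q$ iff $p\leq_{\mathscr F}q$ and $q\leq_{\mathscr F}p$. A $P$-path is a tuple $(p_1,\ldots,p_k)\in P^k$ ($k\geq1$) with $p_1\mathrel{\mathscr F}p_2\mathrel{\mathscr F}\cdots\mathrel{\mathscr F}p_k$, regarded as a morphism $p_1\to p_k$. The path category $\mathscr P(P)$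 has object set $P$, morphisms all $P$-paths, composition $(p_1,\ldots,p_k)\circ(p_k,\ldots,p_l)=(p_1,\ldots,p_k,\ldots,p_l)$, and identities $(p)$, identified with $p$. For $p\in P$, a pair $(e,f)\in P\times P$ is $p$-linked if $f=e\theta_p\theta_f$ and $e=f\theta_p\theta_e$; then $\lambda(e,p,f)=(e,e\theta_p,f)$ and $\rho(e,p,f)=(e,f\theta_p,f)$ are $P$-paths. Let $\equiv$ be the congruence on $\mathscr P(P)$ generated by all pairs $((p,p),(p))$ with $p\in P$, all pairs $((p,q,p),(p))$ with $p\mathrel{\mathscr F}q$, and all pairs $(\lambda(e,p,f),\rho(e,p,f))$ with $p\in P$ and $(e,f)$ a $p$-linked pair. (A congruence on a small category is an equivalence relation on morphisms relating only morphisms with equal domains and equal ranges, and compatible with composition on both sides.) The $\equiv$-class of $(p_1,\ldots,p_k)$ is denoted $[\![p_1,\ldots,p_k]\!]$ and called a reduced chain. The chain semigroup $\mathsf{PG}(P)$ is the set of all reduced chains with involution $[\![p_1,\ldots,p_k]\!]^*=[\![p_k,\ldots,p_1]\!]$ and product $[\![p_1,\ldots,p_k]\!]\bullet[\![q_1,\ldots,q_l]\!]=[\![p_1',\ldots,p_k',q_1',\ldots,q_l']\!]$, where, with $p'=q_1\theta_{p_k}$ and $q'=p_k\theta_{q_1}$, we put $p_i'=p'\theta_{p_k}\theta_{p_{k-1}}\cdots\theta_{p_i}$ and $q_j'=q'\theta_{q_1}\theta_{q_2}\cdots\theta_{q_j}$. *)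

(* Defs.v *)
From HB Require Import structures.
From mathcomp Require Import all_boot.
From mathcomp Require Import boolp.

Set Implicit Arguments.
Unset Strict Implicit.
Unset Printing Implicit Defensive.

Local Open Scope quotient_scope.

Record regular_star_semigroup (S : Type) (mul : S -> S -> S) (star : S -> S) :
    Prop := RegularStarSemigroup {
  rss_mulA : forall a b c, mul a (mul b c) = mul (mul a b) c;
  rss_starK : forall a, star (star a) = a;
  rss_mul_star_mul : forall a, mul (mul a (star a)) a = a;
  rss_starM : forall a b, star (mul a b) = mul (star b) (star a)
}.

Record regStar := RegStar {
  rs_sort :> Type;
  rs_mul : rs_sort -> rs_sort -> rs_sort;
  rs_star : rs_sort -> rs_sort;
  rs_axioms : regular_star_semigroup rs_mul rs_star
}.

Definition is_idempotent (S : regStar) (e : S) : Prop := rs_mul e e = e.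

Definition is_projection (S : regStar) (p : S) : Prop :=
  rs_mul p p = p /\ rs_star p = p.

Inductive generated (S : regStar) (A : S -> Prop) : S -> Prop :=
| generated_in a : A a -> generated A a
| generated_mul a b :
    generated A a -> generated A b -> generated A (rs_mul a b).

Definition projection_generated (S : regStar) : Prop :=
  forall a : S, generated (@is_projection S) a.

Definition idempotent_generated (S : regStar) : Prop :=
  forall a : S, generated (@is_idempotent S) a.

(* [theta p q] is q theta_p: the operations act on the right of their
   arguments and are composed from left to right, so that
   [q \theta_p \theta_r] is q theta_p theta_r. *)

Reserved Notation "q \theta_ p"
  (at level 40, p at level 8, left associativity, format "q  \theta_ p").

Record projection_algebra (P : Type) (theta : P -> P -> P) : Prop :=
    ProjectionAlgebra {
  pa_theta_self : forall p, theta p p = p;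
  pa_theta_idem : forall p x, theta p (theta p x) = theta p x;
  pa_theta_swap : forall p q, theta p (theta q p) = theta p q;
  pa_theta_conj : forall p q x,
    theta p (theta q (theta p x)) = theta (theta p q) x;
  pa_theta_alt : forall p q x,
    theta q (theta p (theta q (theta p x))) = theta q (theta p x)
}.

Record projAlg := ProjAlg {
  pa_sort :> Type;
  theta : pa_sort -> pa_sort -> pa_sort;
  pa_axioms : projection_algebra theta
}.

Notation "q \theta_ p" := (theta p q).

Definition projAlg_iso (P Q : projAlg) (f : P -> Q) : Prop :=
  bijective f /\ forall p q : P, f (q \theta_p) = f q \theta_(f p).

Section Projections.
Variable S : regStar.
Local Notation "a * b" := (@rs_mul S a b).

Let mA (a b c : S) : a * (b * c) = a * b * c.
Proof. exact: rss_mulA (rs_axioms S) a b c. Qed.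

Lemma projection_conj (p q : S) :
  is_projection p -> is_projection q -> is_projection (p * q * p).
Proof.
move=> [pp ps] [qq qs]; have [_ _ sM mS] := rs_axioms S.
split; last by rewrite !mS ps qs mA.
have := sM (p * q); rewrite mS ps qs => pq.
have {}pq : p * q * p * q = p * q.
  by rewrite -[RHS]pq !mA -(mA p q q) qq -(mA (p * q) p p) pp.
by rewrite !mA -(mA (p * q) p p) pp pq.
Qed.

Definition projection : Type := {p : S | is_projection p}.

Definition projection_theta (p q : projection) : projection :=
  exist _ (sval p * sval q * sval p) (projection_conj (svalP p) (svalP q)).

Lemma projection_theta_axioms : projection_algebra projection_theta.
Proof.
have pqpq (p q : S) : is_projection p -> is_projection q ->
    p * q * p * q = p * q.
  move=> [pp ps] [qq qs]; have [_ _ sM mS] := rs_axioms S.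
  have := sM (p * q); rewrite mS ps qs => pq.
  by rewrite -[RHS]pq !mA -(mA p q q) qq -(mA (p * q) p p) pp.
split.
- move=> [p hp]; apply: eq_exist => /=; have [pp _] := hp.
  by rewrite !pp.
- move=> [p hp] [x hx]; apply: eq_exist => /=; have [pp _] := hp.
  by rewrite !mA pp -(mA (p * x) p p) pp.
- move=> [p hp] [q hq]; apply: eq_exist => /=; have [pp _] := hp.
  by rewrite !mA pqpq.
- move=> [p hp] [q hq] [x hx]; apply: eq_exist => /=.
  by rewrite !mA.
- move=> [p hp] [q hq] [x hx]; apply: eq_exist => /=.
  rewrite !mA pqpq //.
  have -> : q * p * x * p * q * p * q = q * p * x * (p * q * p * q).
    by rewrite !mA.
  by rewrite pqpq // !mA.
Qed.

(* P(S), with q theta_p = pqp. *)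
Definition projections : projAlg := ProjAlg projection_theta_axioms.

End Projections.

Section ChainSemigroup.
Variable P : projAlg.
Implicit Types (p q r e f x y : P) (s t : seq P).

Let thetaxx p : p \theta_p = p.
Proof. exact: pa_theta_self (pa_axioms P) p. Qed.
Let theta_idem p x : x \theta_p \theta_p = x \theta_p.
Proof. exact: pa_theta_idem (pa_axioms P) p x. Qed.
Let theta_swap p q : p \theta_q \theta_p = q \theta_p.
Proof. exact: pa_theta_swap (pa_axioms P) p q. Qed.
Let theta_conj p q x : x \theta_p \theta_q \theta_p = x \theta_(q \theta_p).
Proof. exact: pa_theta_conj (pa_axioms P) p q x. Qed.
Let theta_alt p q x :
  x \theta_p \theta_q \theta_p \theta_q = x \theta_p \theta_q.
Proof. exact: pa_theta_alt (pa_axioms P) p q x. Qed.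

Definition leF p q : Prop := p = q \theta_p.
Definition relF p q : Prop := leF p q /\ leF q p.

Lemma relF_sym p q : relF p q -> relF q p.
Proof. by case. Qed.

Fixpoint chained x s : Prop :=
  if s is y :: s' then relF x y /\ chained y s' else True.

(* The P-path (p_1, ..., p_k), k >= 1, has source p_1 and tail
   [:: p_2; ...; p_k]. *)
Record ppath := PPath {
  psrc : P;
  ptail : seq P;
  ppathP : chained psrc ptail
}.

Definition pseq (a : ppath) : seq P := psrc a :: ptail a.
Definition ptgt (a : ppath) : P := last (psrc a) (ptail a).

Lemma pseq_inj : injective pseq.
Proof.
move=> [x s h] [y t k] [/= exy est]; move: h k; rewrite exy est => h k.
by rewrite (Prop_irrelevance h k).
Qed.

Lemma chained_cat x s t :
  chained x (s ++ t) <-> chained x s /\ chained (last x s) t.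
Proof.
elim: s x => [|y s IH] x /=; first by split=> [|[]].
by rewrite (propext (IH y)); split=> [[? []]|[[]]].
Qed.

Definition pnil p : ppath := @PPath p [::] I.

Lemma pcomp_subproof (a b : ppath) :
  ptgt a = psrc b -> chained (psrc a) (ptail a ++ ptail b).
Proof.
move=> ab; apply/chained_cat; split; first exact: ppathP.
by rewrite -/(ptgt a) ab; apply: ppathP.
Qed.

Definition pcomp (a b : ppath) (ab : ptgt a = psrc b) : ppath :=
  PPath (pcomp_subproof ab).

Lemma ppair_subproof p q : relF p q -> chained p [:: q].
Proof. by []. Qed.

Definition ppair p q (pq : relF p q) : ppath := PPath (ppair_subproof pq).

Lemma ptriple_subproof p q r : relF p q -> relF q r -> chained p [:: q; r].
Proof. by []. Qed.

Definition ptriple p q r (pq : relF p q) (qr : relF q r) : ppath :=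
  PPath (ptriple_subproof pq qr).

Lemma relF_refl p : relF p p.
Proof. by split; rewrite /leF thetaxx. Qed.

Definition linked p e f : Prop :=
  f = e \theta_p \theta_f /\ e = f \theta_p \theta_e.

Lemma linked_sym p e f : linked p e f -> linked p f e.
Proof. by case. Qed.

Lemma linked_relF1 p e f : linked p e f -> relF e (e \theta_p).
Proof.
move=> [_ ef].
have epe : e \theta_p \theta_e = e.
  by have := theta_alt p e f; rewrite -ef.
by split; rewrite /leF ?epe // -theta_conj epe.
Qed.

Lemma linked_relF2 p e f : linked p e f -> relF (e \theta_p) f.
Proof. by move=> [fe ef]; split; rewrite /leF // -theta_conj -ef. Qed.

Definition plambda p e f (h : linked p e f) : ppath :=
  ptriple (linked_relF1 h) (linked_relF2 h).

Definition prho p e f (h : linked p e f) : ppath :=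
  ptriple (relF_sym (linked_relF2 (linked_sym h)))
          (relF_sym (linked_relF1 (linked_sym h))).

Lemma pseq_lambda p e f (h : linked p e f) :
  pseq (plambda h) = [:: e; e \theta_p; f].
Proof. by []. Qed.

Lemma pseq_rho p e f (h : linked p e f) :
  pseq (prho h) = [:: e; f \theta_p; f].
Proof. by []. Qed.

Inductive chain_eq : ppath -> ppath -> Prop :=
| chain_eq_dup p : chain_eq (ppair (relF_refl p)) (pnil p)
| chain_eq_back p q (pq : relF p q) :
    chain_eq (ptriple pq (relF_sym pq)) (pnil p)
| chain_eq_linked p e f (h : linked p e f) : chain_eq (plambda h) (prho h)
| chain_eq_refl a : chain_eq a a
| chain_eq_sym a b : chain_eq a b -> chain_eq b a
| chain_eq_trans a b c : chain_eq a b -> chain_eq b c -> chain_eq a c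
| chain_eq_compl c a b (ca : ptgt c = psrc a) (cb : ptgt c = psrc b) :
    chain_eq a b -> chain_eq (pcomp ca) (pcomp cb)
| chain_eq_compr c a b (ac : ptgt a = psrc c) (bc : ptgt b = psrc c) :
    chain_eq a b -> chain_eq (pcomp ac) (pcomp bc).

Lemma chain_eq_ends a b : chain_eq a b -> psrc a = psrc b /\ ptgt a = ptgt b.
Proof.
elim=> //= {a b}.
- by move=> a b _ [-> ->].
- by move=> a b c _ [-> ->] _ [-> ->].
- move=> c a b ca cb _ [_ ab]; split=> //.
  by rewrite /ptgt /= !last_cat -/(ptgt c) {1}ca cb; apply: ab.
- move=> c a b ac bc _ [ab _]; split=> //.
  by rewrite /ptgt /= !last_cat -/(ptgt a) -/(ptgt b) ac bc.
Qed.

Lemma chained_rev x s : chained x s -> chained (last x s) (rev (belast x s)).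
Proof.
elim: s x => [|y s IH] x //= [xy ys]; rewrite rev_cons -cats1.
apply/chained_cat; split; first exact: IH.
have -> : last (last y s) (rev (belast y s)) = y.
  by case: s {ys IH} => [|z s] //=; rewrite rev_cons last_rcons.
by split=> //; apply: relF_sym.
Qed.

Definition pstar (a : ppath) : ppath := PPath (chained_rev (ppathP a)).

Lemma pseq_pstar a : pseq (pstar a) = rev (pseq a).
Proof. by rewrite /pseq /= [in RHS]lastI rev_rcons. Qed.

Lemma relF_theta x p q :
  relF p q -> relF (x \theta_p) (x \theta_p \theta_q).
Proof.
move=> [pq qp].
have h : x \theta_p \theta_q \theta_p = x \theta_p by rewrite theta_conj -pq.
have k : x \theta_p \theta_q \theta_(x \theta_p) = x \theta_p.
  by rewrite -theta_conj h !theta_swap.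
by split; rewrite /leF ?k // -theta_conj k.
Qed.

(* For b = (q_1, ..., q_l), [pdown x b] is the path with j-th vertex
   x theta_{q_1} ... theta_{q_j}. *)
Lemma pdown_subproof x (b : ppath) :
  chained (x \theta_(psrc b)) (scanl (fun y q => y \theta_q)
                                     (x \theta_(psrc b)) (ptail b)).
Proof.
case: b => /= p s; elim: s p x => [|q s IH] p x //= [pq qs].
by split; [apply: relF_theta | apply: IH].
Qed.

Definition pdown x (b : ppath) : ppath := PPath (@pdown_subproof x b).

Lemma pseq_pdown x b :
  pseq (pdown x b) = scanl (fun y q => y \theta_q) x (pseq b).
Proof. by []. Qed.

Lemma relF_cross p q : relF (q \theta_p) (p \theta_q).
Proof.
suff h x y : leF (y \theta_x) (x \theta_y) by split; apply: h.
by rewrite /leF -theta_conj theta_alt theta_swap.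
Qed.

Lemma pcat_subproof (a b : ppath) :
  relF (ptgt a) (psrc b) -> chained (psrc a) (ptail a ++ pseq b).
Proof.
move=> ab; apply/chained_cat; split; first exact: ppathP.
by split=> //; apply: ppathP.
Qed.

Definition pcat (a b : ppath) (ab : relF (ptgt a) (psrc b)) : ppath :=
  PPath (pcat_subproof ab).

Lemma ptgt_pstar a : ptgt (pstar a) = psrc a.
Proof.
case: a => x [|y s] h //=; rewrite /ptgt /=.
by rewrite rev_cons last_rcons.
Qed.

Lemma pprod_subproof (a b : ppath) :
  relF (ptgt (pstar (pdown (psrc b \theta_(ptgt a)) (pstar a))))
       (psrc (pdown (ptgt a \theta_(psrc b)) b)).
Proof. by rewrite ptgt_pstar /= !theta_idem; apply: relF_cross. Qed.

(* The product of paths; [pseq_pprod] gives its vertices explicitly. *)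
Definition pprod (a b : ppath) : ppath := pcat (@pprod_subproof a b).

Lemma pseq_pprod a b :
  let p' := psrc b \theta_(ptgt a) in
  let q' := ptgt a \theta_(psrc b) in
  pseq (pprod a b) = rev (scanl (fun y p => y \theta_p) p' (rev (pseq a)))
                  ++ scanl (fun y q => y \theta_q) q' (pseq b).
Proof.
by rewrite /= -pseq_pstar -pseq_pdown -pseq_pstar -[X in _ ++ X]pseq_pdown.
Qed.

Lemma chain_eq_seq a b a' b' :
  chain_eq a b -> pseq a = pseq a' -> pseq b = pseq b' -> chain_eq a' b'.
Proof. by move=> ab /pseq_inj <- /pseq_inj <-. Qed.

Lemma pstar_chain_eq a b : chain_eq a b -> chain_eq (pstar a) (pstar b).
Proof.
elim=> {a b}.
- by move=> p; apply: chain_eq_seq (chain_eq_dup p) _ _; rewrite pseq_pstar.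
- by move=> p q h; apply: chain_eq_seq (chain_eq_back h) _ _; rewrite pseq_pstar.
- move=> p e f h; have k := chain_eq_linked (linked_sym h).
  by apply: chain_eq_seq (chain_eq_sym k) _ _; rewrite pseq_pstar.
- by move=> a; apply: chain_eq_refl.
- by move=> a b _; apply: chain_eq_sym.
- by move=> a b c _ + _; apply: chain_eq_trans.
- move=> c a b ca cb _ IH.
  have E d (cd : ptgt c = psrc d) (dc : ptgt (pstar d) = psrc (pstar c)) :
      pstar (pcomp cd) = pcomp dc.
    apply: pseq_inj; rewrite pseq_pstar /pseq /=.
    rewrite -cat_cons lastI cat_rcons.
    rewrite [last (psrc c) (ptail c)]cd rev_cat.
    by rewrite -/(pseq d) -pseq_pstar.
  have ac : ptgt (pstar a) = psrc (pstar c) by rewrite ptgt_pstar -ca.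
  have bc : ptgt (pstar b) = psrc (pstar c) by rewrite ptgt_pstar -cb.
  by rewrite (E _ _ ac) (E _ _ bc); apply: chain_eq_compr.
- move=> c a b ac bc _ IH.
  have E d (dc : ptgt d = psrc c) (cd : ptgt (pstar c) = psrc (pstar d)) :
      pstar (pcomp dc) = pcomp cd.
    apply: pseq_inj; rewrite pseq_pstar /pseq /=.
    rewrite -cat_cons lastI cat_rcons.
    rewrite [last (psrc d) (ptail d)]dc rev_cat.
    by rewrite -/(pseq c) -pseq_pstar.
  have ca : ptgt (pstar c) = psrc (pstar a) by rewrite ptgt_pstar -ac.
  have cb : ptgt (pstar c) = psrc (pstar b) by rewrite ptgt_pstar -bc.
  by rewrite (E _ _ ca) (E _ _ cb); apply: chain_eq_compl.
Qed.

Lemma pdown_pcomp x y a b (ab : ptgt a = psrc b) :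
  y = ptgt (pdown x a) ->
  exists h : ptgt (pdown x a) = psrc (pdown y b),
    pdown x (pcomp ab) = pcomp h.
Proof.
move=> ->.
have h : ptgt (pdown x a) = psrc (pdown (ptgt (pdown x a)) b).
  rewrite /= -ab; case: a {ab} => [p s hs]; rewrite /ptgt /=.
  by case/lastP: s hs => [|s q] hs; rewrite /= ?theta_idem //
     -cats1 scanl_cat /= !last_cat /= theta_idem.
exists h; apply: pseq_inj; rewrite /pseq /= scanl_cat; congr (_ :: _ ++ _).
move: h; rewrite /= => <-; congr scanl.
by case: a {ab} => p s hs; rewrite /ptgt /=; elim: s (x \theta_p) {hs} => /=.
Qed.

(* If (e, f) is p-linked and r = x theta_e, then (r, r theta_p theta_f) is
   p-linked. *)
Lemma linked_restrict x p e f (h : linked p e f) (r := x \theta_e) :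
  [/\ linked p r (r \theta_p \theta_f),
      r \theta_(e \theta_p) = r \theta_p,
      r \theta_(f \theta_p) = r \theta_p \theta_f \theta_p &
      r \theta_(f \theta_p) \theta_f = r \theta_p \theta_f].
Proof.
have [fe ef] := h.
have rK : r \theta_p \theta_f \theta_p \theta_r = r.
  have E y : y \theta_r = y \theta_e \theta_r by rewrite -!theta_conj theta_idem.
  by rewrite theta_conj E (theta_conj e) -ef thetaxx.
split; first by split; rewrite // -!theta_conj theta_conj rK.
- by rewrite -theta_conj theta_alt.
- by rewrite -theta_conj.
- by rewrite -theta_conj theta_alt.
Qed.

Lemma pdown_chain_eq x a b :
  chain_eq a b -> chain_eq (pdown x a) (pdown x b).
Proof.
move=> ab; elim: ab x => {a b}.
- move=> p x; apply: chain_eq_seq (chain_eq_dup (x \theta_p)) _ _ => //.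
  by rewrite /pseq /= theta_idem.
- move=> p q h x.
  apply: chain_eq_seq (chain_eq_back (relF_theta x h)) _ _ => //.
  by rewrite /pseq /= theta_conj -(proj1 h).
- move=> p e f h x; have [k k1 k2 k3] := linked_restrict x h.
  by apply: chain_eq_seq (chain_eq_linked k) _ _; rewrite /pseq /= ?k1 ?k3 ?k2.
- by move=> a x; apply: chain_eq_refl.
- by move=> a b _ IH x; apply: chain_eq_sym.
- by move=> a b c _ IH1 _ IH2 x; apply: chain_eq_trans (IH2 x).
- move=> c a b ca cb _ IH x.
  have [h ->] := pdown_pcomp ca (erefl (ptgt (pdown x c))).
  have [k ->] := pdown_pcomp cb (erefl (ptgt (pdown x c))).
  exact: chain_eq_compl.
- move=> c a b ac bc _ IH x.
  have E := esym (proj2 (chain_eq_ends (IH x))).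
  have [h ->] := pdown_pcomp ac E.
  have [k ->] := pdown_pcomp bc (erefl (ptgt (pdown x b))).
  exact: chain_eq_compr.
Qed.

Lemma pcat_chain_eq a a' b b' (h : relF (ptgt a) (psrc b))
    (h' : relF (ptgt a') (psrc b')) :
  chain_eq a a' -> chain_eq b b' -> chain_eq (pcat h) (pcat h').
Proof.
move=> aa bb; have [_ ta] := chain_eq_ends aa; have [sb _] := chain_eq_ends bb.
have E c d (k : relF (ptgt c) (psrc d))
    (k1 : ptgt c = psrc (ppair k)) (k2 : ptgt (pcomp k1) = psrc d) :
    pcat k = pcomp k2.
  by apply: pseq_inj; rewrite /pseq /= -catA.
have T c d (k : relF (ptgt c) (psrc d)) (k1 : ptgt c = psrc (ppair k)) :
  ptgt (pcomp k1) = psrc d by rewrite /ptgt /= last_cat.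
rewrite (E _ _ h erefl (T _ _ h erefl)) (E _ _ h' erefl (T _ _ h' erefl)).
set k2 := T _ _ h _; set k2' := T _ _ h' _.
have k3 : ptgt (pcomp (erefl : ptgt a = psrc (ppair h))) = psrc b'.
  by rewrite k2.
apply: chain_eq_trans (chain_eq_compl k2 k3 bb) _.
apply: chain_eq_compr.
have k4 : ptgt a' = psrc (ppair h) by rewrite -ta.
have k5 : ptgt a = psrc (ppair h) by [].
apply: chain_eq_seq (chain_eq_compr k5 k4 aa) _ _ => //.
by rewrite /pseq /= sb.
Qed.

Lemma pprod_chain_eq a a' b b' :
  chain_eq a a' -> chain_eq b b' -> chain_eq (pprod a b) (pprod a' b').
Proof.
move=> aa bb; have [_ ta] := chain_eq_ends aa; have [sb _] := chain_eq_ends bb.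
apply: pcat_chain_eq; rewrite ta sb; last exact: pdown_chain_eq.
by apply/pstar_chain_eq/pdown_chain_eq/pstar_chain_eq.
Qed.

HB.instance Definition _ := gen_eqMixin ppath.
HB.instance Definition _ := gen_choiceMixin ppath.

Definition chain_eqb (a b : ppath) : bool := `[< chain_eq a b >].

Lemma chain_eqb_refl : reflexive chain_eqb.
Proof. by move=> a; apply/asboolP/chain_eq_refl. Qed.

Lemma chain_eqb_sym : symmetric chain_eqb.
Proof.
by move=> a b; apply/asboolP/asboolP => /chain_eq_sym.
Qed.

Lemma chain_eqb_trans : transitive chain_eqb.
Proof.
by move=> b a c /asboolP ab /asboolP bc; apply/asboolP/(chain_eq_trans ab bc).
Qed.

Canonical chain_equiv :=
  EquivRel chain_eqb chain_eqb_refl chain_eqb_sym chain_eqb_trans.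

Definition PG : Type := {eq_quot chain_equiv}.

Definition reduced_chain (a : ppath) : PG := \pi_{eq_quot chain_equiv} a.

(* These operations use representatives; [PG_starE] and [PG_mulE] below show
   that the choice of representatives does not matter. *)
Definition PG_star (c : PG) : PG :=
  reduced_chain (pstar (repr (c : {eq_quot chain_equiv}))).

Definition PG_mul (c d : PG) : PG :=
  reduced_chain (pprod (repr (c : {eq_quot chain_equiv}))
                       (repr (d : {eq_quot chain_equiv}))).

Lemma reduced_chainP a b :
  reduced_chain a = reduced_chain b <-> chain_eq a b.
Proof.
by split=> [/eqmodP/asboolP | h]; last exact/eqmodP/asboolP.
Qed.

Lemma PG_starE a : PG_star (reduced_chain a) = reduced_chain (pstar a).
Proof.
by apply/reduced_chainP/pstar_chain_eq/reduced_chainP; rewrite /reduced_chain reprK.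
Qed.

Lemma PG_mulE a b :
  PG_mul (reduced_chain a) (reduced_chain b) = reduced_chain (pprod a b).
Proof.
by apply/reduced_chainP/pprod_chain_eq; apply/reduced_chainP;
   rewrite /reduced_chain reprK.
Qed.

End ChainSemigroup.

(* Main.v *)
Require Import Defs.
From mathcomp Require Import all_boot.
From mathcomp Require Import boolp.

(** For a path b = (q_1, ..., q_k) write T_b for the composite of
    theta_{q_1}, ..., theta_{q_k} and b* for the reversed path.  Because
    theta_q theta_r theta_q = theta_q whenever q and r are F-related, T_b
    followed by T_{b*} is theta_{q_1}; so moving a projection along b and back
    only cuts it down to the first vertex, and a restriction of b may be
    computed from either of its ends ([act_rev], [up_down]).

    Associativity is the substance of the theorem.  Let a end at p, let c start
    at s, and put e = s T_{b*} theta_p and f = p T_b theta_s.  In both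
    bracketings of a b c the factor a gets restricted so as to end at e, and c
    so as to start at f.  They differ in the middle: (a b) c goes from e to f
    along the images of e under b read forwards, while a (b c) goes along the
    images of f under b read backwards ([pprod_left], [pprod_right]; the second
    follows from the first by the involution).  When b is a single projection q,
    the pair (e, f) is q-linked and the two middles are lambda(e, q, f) and
    rho(e, q, f), which the congruence identifies.  In general (e, f) is linked
    along b, in the sense of the hypotheses of [chain_eq_seqs_linked], and the
    forward vertices can be exchanged for backward ones one at a time, starting
    from the end of b, by one such generating pair for each vertex of b.

    The other facts come from direct computations.  The product a a* is the
    path a followed by its reversal, which folds up to the trivial path at the
    source of a ([pprod_pstar]); this yields a a* a = a, and it also shows that
    a projection c = c c* is the class of a single vertex.  Putting p in front
    of a path that starts at a vertex F-related to p is left multiplication by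
    (p) ([pprod_nil_l]), so every chain is the product of its vertices.
    Finally (p)(q)(p) is the path (q theta_p, p theta_q, q theta_p), which collapses to
    q theta_p ([pprod_nil_conj]), so the identification of P with the
    projections respects the operations. *)

Set Implicit Arguments.
Unset Strict Implicit.
Unset Printing Implicit Defensive.

(** * Moving a projection along a sequence *)

Section ChainSemigroupTheory.
Variable P : projAlg.
Implicit Types (p q r e f x y z : P) (s t u v : seq P) (a b c : ppath P).

Lemma theta_self p : p \theta_p = p.
Proof. exact: pa_theta_self (pa_axioms P) p. Qed.

Lemma theta_idem p x : x \theta_p \theta_p = x \theta_p.
Proof. exact: pa_theta_idem (pa_axioms P) p x. Qed.

Lemma theta_swap p q : p \theta_q \theta_p = q \theta_p.
Proof. exact: pa_theta_swap (pa_axioms P) p q. Qed.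

Lemma theta_conj p q x : x \theta_(q \theta_p) = x \theta_p \theta_q \theta_p.
Proof. by rewrite (pa_theta_conj (pa_axioms P)). Qed.

Lemma theta_alt p q x :
  x \theta_p \theta_q \theta_p \theta_q = x \theta_p \theta_q.
Proof. exact: pa_theta_alt (pa_axioms P) p q x. Qed.

(** The identity behind the fact that q theta_p and p theta_q are F-related:
    it makes the junction of a product into a path. *)
Lemma theta_cross p q : q \theta_p \theta_(p \theta_q) = p \theta_q.
Proof. by rewrite theta_conj theta_alt theta_swap. Qed.

Definition act x s : P := foldl (fun y q => y \theta_q) x s.
Definition down x s : seq P := scanl (fun y q => y \theta_q) x s.

(** The mirror image of [down]: x enters at the end of s and moves towards its
    head, but the vertices are listed in the order of s. *)
Definition up s x : seq P := rev (down x (rev s)).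

Lemma act_rcons x s q : act x (rcons s q) = act x s \theta_q.
Proof. exact: foldl_rcons. Qed.

Lemma act_cat x s t : act x (s ++ t) = act (act x s) t.
Proof. exact: foldl_cat. Qed.

Lemma down_cat x s t : down x (s ++ t) = down x s ++ down (act x s) t.
Proof. exact: scanl_cat. Qed.

Lemma last_down x s : last x (down x s) = act x s.
Proof. by elim: s x => //= q s IH x; apply: IH. Qed.

Lemma up_cat s t x : up (s ++ t) x = up s (act x (rev t)) ++ up t x.
Proof. by rewrite /up rev_cat down_cat rev_cat. Qed.

Lemma up_cons q s x : up (q :: s) x = act x (rev (q :: s)) :: up s x.
Proof. by rewrite -cat1s up_cat rev_cat act_cat. Qed.

(** The conjugation axiom iterated: writing T_s for the action of s, the
    operation of x T_s is T_{rev s} theta_x T_s. *)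
Lemma act_conj y x s : y \theta_(act x s) = act (act y (rev s) \theta_x) s.
Proof.
elim/last_ind: s y => [|s q IH] y //=.
by rewrite !act_rcons theta_conj IH rev_rcons.
Qed.

(** Restricting a restriction: once y lies below x, the conjugation and
    alternation axioms make the vertices x theta_{q_1} ... theta_{q_i} act on
    it exactly as the q_i do. *)
Lemma down_down_theta y x s :
  down (y \theta_x) (down x s) = down (y \theta_x) s.
Proof.
elim: s x y => //= q s IH x y.
have -> : y \theta_x \theta_q = y \theta_x \theta_(x \theta_q).
  by rewrite theta_conj theta_alt.
by congr (_ :: _); apply: IH.
Qed.

Lemma down_down y x a :
  down y (down x (pseq a)) = down (y \theta_(x \theta_(psrc a))) (pseq a).
Proof.
rewrite /pseq /=; set u := x \theta_(psrc a).
have -> : y \theta_u \theta_(psrc a) = y \theta_u.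
  by rewrite theta_conj theta_idem.
by congr (_ :: _); apply: down_down_theta.
Qed.

Lemma act_down_act y x a :
  act y (down x (pseq a)) = act (y \theta_(x \theta_(psrc a))) (pseq a).
Proof. by rewrite -!last_down down_down. Qed.

Lemma down_src x a : down (x \theta_(psrc a)) (pseq a) = down x (pseq a).
Proof. by rewrite /pseq /= theta_idem. Qed.

Lemma act_src x a : act (x \theta_(psrc a)) (pseq a) = act x (pseq a).
Proof. by rewrite /pseq /= theta_idem. Qed.

Lemma up_tgt a x : up (pseq a) (x \theta_(ptgt a)) = up (pseq a) x.
Proof. by rewrite /up -pseq_pstar -(down_src x (pstar a)). Qed.

Lemma act_tgt x a : act x (pseq a) \theta_(ptgt a) = act x (pseq a).
Proof. by rewrite /pseq lastI act_rcons theta_idem. Qed.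

(** Along a path this holds by telescoping: the innermost pair
    theta_q theta_r theta_q of consecutive vertices collapses to theta_q. *)
Lemma act_rev x a : act (act x (pseq a)) (rev (pseq a)) = x \theta_(psrc a).
Proof.
case: a => [p s h]; rewrite /pseq /=.
elim: s p x h => [|q s IH] p x /= => [_|[pq h]]; first exact: theta_idem.
by rewrite rev_cons act_rcons (IH q) // -theta_conj -(proj1 pq).
Qed.

(** A restriction of a path is determined by its first vertex just as well as
    by its last one, since consecutive operations along a path are mutually
    inverse on the images. *)
Lemma up_down a x : up (pseq a) x = down (act x (rev (pseq a))) (pseq a).
Proof.
case: a => [p s h]; rewrite /pseq /=.
elim: s p x h => [|q s IH] p x /= => [_|[pq h]].
  by rewrite /up /= theta_idem.
rewrite up_cons IH // rev_cons act_rcons /= theta_idem.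
suff -> : act x (rev (q :: s)) \theta_p \theta_q
        = act x (rev (q :: s)) \theta_q by [].
by rewrite rev_cons act_rcons -theta_conj -(proj2 pq) theta_idem.
Qed.

(** * The two bracketings of a triple product *)

(** The projections q theta_p and p theta_q of the definition may be replaced
    by q and p, as the first step of each restriction applies theta_p and
    theta_q anyway. *)
Lemma pprodE a b :
  pseq (pprod a b) = up (pseq a) (psrc b) ++ down (ptgt a) (pseq b).
Proof. by rewrite pseq_pprod -up_tgt -(down_src (ptgt a)). Qed.

Lemma ptgt_pprod a b : ptgt (pprod a b) = act (ptgt a) (pseq b).
Proof.
rewrite -act_src -last_down /ptgt /= last_cat /=.
by rewrite /pseq /= !theta_idem.
Qed.

Lemma pstarK a : pstar (pstar a) = a.
Proof. by apply: pseq_inj; rewrite !pseq_pstar revK. Qed.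

Lemma psrc_pstar a : psrc (pstar a) = ptgt a.
Proof. by []. Qed.

Lemma pstar_pprod a b : pstar (pprod a b) = pprod (pstar b) (pstar a).
Proof.
apply: pseq_inj.
by rewrite !(pprodE, pseq_pstar) rev_cat /up !revK ptgt_pstar.
Qed.

(** The last vertex of the product of a and b is p T_b, where p is the end of
    a.  By [act_conj] its operation is T_{b*} theta_p T_b, and [act_rev] removes
    the detour through b that arises when the start s of c is pushed back to the
    start q of b; what remains is s T_{b*} theta_p theta_q. *)
Lemma pprod_left a b c
    (e := act (psrc c) (rev (pseq b)) \theta_(ptgt a))
    (f := act (ptgt a) (pseq b) \theta_(psrc c)) :
  pseq (pprod (pprod a b) c)
  = up (pseq a) e ++ down e (pseq b) ++ down f (pseq c).
Proof.
rewrite {}/e {}/f pprodE ptgt_pprod pprodE up_cat -catA down_src.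
set p := ptgt a; set q := psrc b; set w := act _ (rev (pseq b)).
have wq : w \theta_q = w.
  have := act_tgt (psrc c) (pstar b).
  by rewrite pseq_pstar ptgt_pstar.
have revD : rev (down p (pseq b)) = down (act p (pseq b)) (rev (pseq b)).
  by have := up_down (pstar b) p; rewrite pseq_pstar /up revK.
have wE : act (psrc c) (rev (down p (pseq b))) = w \theta_p \theta_q.
  rewrite revD -pseq_pstar act_down_act psrc_pstar act_tgt.
  by rewrite act_conj pseq_pstar act_rev.
congr (_ ++ (_ ++ _)).
- rewrite wE /up revK -pseq_pstar down_down psrc_pstar -/p.
  by rewrite theta_conj theta_alt -{1}wq theta_alt wq.
- rewrite -[down p _](pseq_pdown p b) up_down pseq_pdown -/(down _ _) wE.
  rewrite -/(down p _) down_down -/q theta_conj theta_idem theta_alt.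
  exact: down_src.
Qed.

Lemma pprod_right a b c
    (e := act (psrc c) (rev (pseq b)) \theta_(ptgt a))
    (f := act (ptgt a) (pseq b) \theta_(psrc c)) :
  pseq (pprod a (pprod b c))
  = up (pseq a) e ++ up (pseq b) f ++ down f (pseq c).
Proof.
have -> : pprod a (pprod b c)
    = pstar (pprod (pprod (pstar c) (pstar b)) (pstar a)).
  by rewrite -!pstar_pprod pstarK.
rewrite pseq_pstar pprod_left !rev_cat -catA !pseq_pstar.
by rewrite ptgt_pstar psrc_pstar /up !revK.
Qed.

(** * The congruence on sequences of vertices *)

(** Paths carry a proof of F-relatedness; this is their congruence transported
    to the underlying sequences, where rewriting inside a context needs no
    transport of proofs. *)
Definition chain_eq_seqs s t : Prop :=
  exists a b, [/\ pseq a = s, pseq b = t & chain_eq a b].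

Definition is_chain s : Prop := if s is x :: s' then chained x s' else False.

Lemma pseq_is_chain a : is_chain (pseq a).
Proof. exact: ppathP. Qed.

Lemma is_chainP s : is_chain s -> exists a, pseq a = s.
Proof. by case: s => //= x s h; exists (PPath h). Qed.

Lemma chain_eq_seqs_refl s : is_chain s -> chain_eq_seqs s s.
Proof.
by move=> /is_chainP[a <-]; exists a, a; split=> //; apply: chain_eq_refl.
Qed.

Lemma chain_eq_seqs_trans t s u :
  chain_eq_seqs s t -> chain_eq_seqs t u -> chain_eq_seqs s u.
Proof.
move=> [a [b [<- <- ab]]] [c [d [/pseq_inj -> <- cd]]].
by exists a, d; split=> //; apply: chain_eq_trans cd.
Qed.

Lemma chain_eq_seqs_cons x y s t :
  relF x (head y s) -> chain_eq_seqs s t -> chain_eq_seqs (x :: s) (x :: t).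
Proof.
move=> xs [a [b [sE <- ab]]]; rewrite -sE /= in xs *.
have xa : relF x (psrc a) := xs.
have xb : relF x (psrc b) by rewrite -(proj1 (chain_eq_ends ab)).
exists (@pcat _ (pnil x) a xa), (@pcat _ (pnil x) b xb); split=> //.
by apply: pcat_chain_eq => //; apply: chain_eq_refl.
Qed.

Lemma chain_eq_seqs_catr s t v :
  is_chain (s ++ v) -> chain_eq_seqs s t -> chain_eq_seqs (s ++ v) (t ++ v).
Proof.
move=> sv [a [b [sE <- ab]]]; rewrite -sE {s sE} in sv *.
case: v sv => [|x v] sv.
  by rewrite !cats0; exists a, b.
move: sv => /chained_cat[_ [ax xv]].
have bx : relF (ptgt b) x by rewrite -(proj2 (chain_eq_ends ab)).
exists (@pcat _ a (PPath xv) ax), (@pcat _ b (PPath xv) bx); split=> //.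
by apply: pcat_chain_eq => //; apply: chain_eq_refl.
Qed.

Lemma chain_eq_seqs_cat u s t v : is_chain (u ++ s ++ v) ->
  chain_eq_seqs s t -> chain_eq_seqs (u ++ s ++ v) (u ++ t ++ v).
Proof.
move=> + st; elim: u => [|x u IH] /= h; first exact: chain_eq_seqs_catr.
have [a [_ [sa _ _]]] := st.
case E: (u ++ s ++ v) h IH => [|y w] h IH.
  by rewrite -sa in E; case: u E {h IH}.
by case: h => xy yw; apply: (@chain_eq_seqs_cons _ y) => //; apply: IH.
Qed.

(** The pair (e, f) is linked along the whole of s.  Both e theta_q with f along
    the tail of s, and e with the last image f_2 of f before q along q alone,
    are linked again; so induction turns the forward route into the backward
    one behind e theta_q, and one generating pair then replaces e theta_q. *)
Lemma chain_eq_seqs_linked s e f :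
  f = act e s \theta_f -> e = act f (rev s) \theta_e ->
  chain_eq_seqs (e :: rcons (down e s) f) (e :: rcons (up s f) f).
Proof.
elim: s e f => [|q s IH] e f /=.
  by move=> fe ef; apply: chain_eq_seqs_refl.
set e1 := e \theta_q; set f2 := act f (rev s).
rewrite rev_cons act_rcons -/f2 => fe ef.
have f2E : f2 = e1 \theta_f2.
  by rewrite {2}/f2 act_conj revK -fe.
have lk : linked q e f2 by [].
have st : chain_eq_seqs (e1 :: rcons (down e1 s) f) (e1 :: rcons (up s f) f).
  by apply: IH; rewrite // -/f2 {2}/e1 theta_conj -ef.
apply: (@chain_eq_seqs_trans (e :: e1 :: rcons (up s f) f)).
  by apply: (@chain_eq_seqs_cons _ e1) st; apply: (linked_relF1 lk).
rewrite up_cons rev_cons act_rcons -/f2 /=.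
have [v vE] : exists v, rcons (up s f) f = f2 :: v.
  rewrite /f2; case: s {IH e1 f2 fe ef f2E lk st} => [|r s].
    by exists [::].
  by rewrite up_cons; exists (rcons (up s f) f).
have [_ [c [_ cE _]]] := st.
rewrite vE.
apply: (@chain_eq_seqs_catr [:: e; e1; f2] [:: e; f2 \theta_q; f2] v).
  split; first exact: (linked_relF1 lk).
  by have := pseq_is_chain c; rewrite cE vE.
by exists (plambda lk), (prho lk); split=> //; apply: chain_eq_linked.
Qed.

(** * The laws of a regular star-semigroup, for paths *)

(** With t = p T_b and w = s T_{b*}, both conditions for (e, f) to be linked
    along b are instances of [theta_cross]: e T_b = s theta_t with
    f = t theta_s, and f T_{b*} = p theta_w with e = w theta_p. *)
Lemma pprodA a b c :
  chain_eq (pprod a (pprod b c)) (pprod (pprod a b) c).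
Proof.
have seqE := pprod_left a b c.
suff [d [d' [dE dE' dd']]] :
    chain_eq_seqs (pseq (pprod (pprod a b) c)) (pseq (pprod a (pprod b c))).
  by apply: chain_eq_sym; apply: chain_eq_seq dd' dE dE'.
have := pseq_is_chain (pprod (pprod a b) c).
rewrite seqE pprod_right {seqE}.
set w := act (psrc c) (rev (pseq b)); set t := act (ptgt a) (pseq b).
set e := w \theta_(ptgt a); set f := t \theta_(psrc c).
have -> : up (pseq a) e = rev (down e (ptail (pstar a))) ++ [:: e].
  by rewrite /up -pseq_pstar /pseq /= theta_idem rev_cons cats1.
have -> : down f (pseq c) = f :: down f (ptail c).
  by rewrite /pseq /= theta_idem.
have L (m : seq P) v :
    [:: e] ++ m ++ f :: v = (e :: rcons m f) ++ v by rewrite /= cat_rcons.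
rewrite -!catA !L => h; apply: chain_eq_seqs_cat => //.
apply: chain_eq_seqs_linked.
- rewrite /f {1}/e -act_conj -/t.
  exact/esym/theta_cross.
- have -> : act f (rev (pseq b)) = ptgt a \theta_w.
    by rewrite act_conj revK.
  exact/esym/theta_cross.
Qed.

(** The innermost pair is a duplicated vertex, and after removing it every
    further layer is a back-and-forth step. *)
Lemma chain_eq_seqs_fold a : chain_eq_seqs (pseq a ++ rev (pseq a)) [:: psrc a].
Proof.
case: a => [x s h]; rewrite /pseq /=.
elim: s x h => [|y s IH] x h.
  by exists (ppair (relF_refl x)), (pnil x); split=> //; apply: chain_eq_dup.
have [xy ys] := h.
have ch : is_chain ((x :: y :: s) ++ rev (x :: y :: s)).
  by have := pseq_is_chain (@pcat _ (PPath h) (pstar (PPath h)) (relF_refl _));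
     rewrite -[rev _](pseq_pstar (PPath h)).
rewrite rev_cons -cats1 in ch *; rewrite cat_cons catA in ch *.
apply: (@chain_eq_seqs_trans ([:: x] ++ [:: y] ++ [:: x])).
  pose m := (y :: s) ++ rev (y :: s).
  exact: (@chain_eq_seqs_cat [:: x] m [:: y] [:: x] ch (IH y ys)).
exists (ptriple xy (relF_sym xy)), (pnil x).
by split=> //; apply: chain_eq_back.
Qed.

Lemma down_id a : down (psrc a) (pseq a) = pseq a.
Proof.
case: a => [p s h]; rewrite /pseq /= theta_self.
by congr (_ :: _); elim: s p h => //= q s IH p [[_ <-] h]; rewrite IH.
Qed.

Lemma pprod_pstar a : chain_eq (pprod a (pstar a)) (pnil (psrc a)).
Proof.
have [b [c [bE cE bc]]] := chain_eq_seqs_fold a.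
apply: (chain_eq_seq bc) => //; rewrite bE pprodE /up -pseq_pstar psrc_pstar.
by rewrite -(psrc_pstar a) down_id pseq_pstar revK.
Qed.

(** The product cuts nothing off, since p and the start of a are F-related. *)
Lemma pprod_nil_l p a : relF p (psrc a) ->
  pseq (pprod (pnil p) a) = p :: pseq a.
Proof.
move=> [pa ap]; rewrite pprodE -(down_src _ a) -[_ \theta_(psrc a)]ap down_id.
by rewrite /up /= -pa.
Qed.

Lemma pprod_src a : chain_eq (pprod (pnil (psrc a)) a) a.
Proof.
have [b [c [bE cE bc]]] : chain_eq_seqs (psrc a :: pseq a) (pseq a).
  apply: (@chain_eq_seqs_catr [:: psrc a; psrc a] [:: psrc a] (ptail a)).
    by split; [apply: relF_refl | apply: ppathP].
  exists (ppair (relF_refl (psrc a))), (pnil (psrc a)).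
  by split=> //; apply: chain_eq_dup.
apply: (chain_eq_seq bc) => //; rewrite bE pprod_nil_l //; apply: relF_refl.
Qed.

(** Up to the absorption laws the product is the path
    (q theta_p, p theta_q, q theta_p), a back-and-forth step. *)
Lemma pprod_nil_conj p q :
  chain_eq (pprod (pprod (pnil p) (pnil q)) (pnil p)) (pnil (q \theta_p)).
Proof.
have pq := relF_cross p q.
apply: chain_eq_seq (chain_eq_back pq) _ _ => //.
rewrite pprod_left /up /pseq /ptgt /=.
by rewrite !theta_swap !theta_idem.
Qed.

End ChainSemigroupTheory.

(** * The chain semigroup and its projections *)

Section ChainStar.
Local Open Scope quotient_scope.
Variable P : projAlg.
Implicit Types (p q : P) (a b : ppath P) (c d : PG P).

Definition vertex p : PG P := reduced_chain (pnil p).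
Definition source c : P := psrc (repr (c : {eq_quot chain_equiv P})).

Lemma reduced_chain_ind (K : PG P -> Prop) :
  (forall a, K (reduced_chain a)) -> forall c, K c.
Proof. by move=> Ka c; rewrite -[c]reprK; apply: Ka. Qed.

Lemma sourceE a : source (reduced_chain a) = psrc a.
Proof.
have /reduced_chainP/chain_eq_ends[] // :
  reduced_chain (repr (reduced_chain a : {eq_quot chain_equiv P}))
  = reduced_chain a by rewrite /reduced_chain reprK.
Qed.

(** This one formula gives both regularity and the determination of the
    projections. *)
Lemma PG_mul_star c : PG_mul c (PG_star c) = vertex (source c).
Proof.
elim/reduced_chain_ind: c => a; rewrite PG_starE PG_mulE sourceE.
exact/reduced_chainP/pprod_pstar.
Qed.

Lemma PG_regular_star : regular_star_semigroup (@PG_mul P) (@PG_star P).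
Proof.
split.
- elim/reduced_chain_ind=> a; elim/reduced_chain_ind=> b.
  elim/reduced_chain_ind=> c; rewrite !PG_mulE.
  exact/reduced_chainP/pprodA.
- by elim/reduced_chain_ind=> a; rewrite !PG_starE pstarK.
- move=> c; rewrite PG_mul_star; elim/reduced_chain_ind: c => a.
  by rewrite sourceE PG_mulE; apply/reduced_chainP/pprod_src.
- elim/reduced_chain_ind=> a; elim/reduced_chain_ind=> b.
  by rewrite !(PG_starE, PG_mulE) pstar_pprod.
Qed.

Definition PGS : regStar := RegStar PG_regular_star.

Lemma vertex_projection p : @is_projection PGS (vertex p).
Proof.
have pstar_nil : pstar (pnil p) = pnil p by apply: pseq_inj; rewrite pseq_pstar.
split; rewrite /= /vertex.
  rewrite PG_mulE -{2}pstar_nil; apply/reduced_chainP/pprod_pstar.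
by rewrite PG_starE pstar_nil.
Qed.

(** A projection satisfies c = c c = c c*, which is a vertex. *)
Lemma projection_vertex (c : PGS) : is_projection c -> vertex (source c) = c.
Proof.
by move=> [cc cs]; rewrite -PG_mul_star -[X in PG_mul _ X]/(rs_star c) cs.
Qed.

Lemma PG_generated (A : PGS -> Prop) :
  (forall p, A (vertex p)) -> forall c, generated A c.
Proof.
move=> vA; elim/reduced_chain_ind=> -[p s h].
elim: s p h => [|q s IH] p h.
  suff -> : PPath h = pnil p by apply: generated_in; apply: vA.
  exact: pseq_inj.
have [pq qs] := h.
suff -> : reduced_chain (PPath h)
        = @rs_mul PGS (vertex p) (reduced_chain (PPath qs)).
  by apply: generated_mul; [apply: generated_in | apply: IH].
rewrite /= PG_mulE; congr reduced_chain; apply: pseq_inj.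
by rewrite pprod_nil_l.
Qed.

Definition to_projection p : projections PGS :=
  exist _ (vertex p) (vertex_projection p).

Lemma to_projection_iso : projAlg_iso to_projection.
Proof.
split.
  exists (fun c : projections PGS => source (sval c)) => [p | [c cP]] /=.
    exact: sourceE.
  by apply: eq_exist; apply: projection_vertex.
move=> p q; apply: eq_exist; rewrite /= (PG_mulE (pnil p) (pnil q)) PG_mulE.
exact/esym/reduced_chainP/pprod_nil_conj.
Qed.

End ChainStar.

Theorem theorem4p22 (P : projAlg) :
  exists H : regular_star_semigroup (@PG_mul P) (@PG_star P),
    let PGP := RegStar H in
    [/\ projection_generated PGP,
        idempotent_generated PGP &
        exists f : P -> projections PGP,
          (forall p : P, sval (f p) = reduced_chain (pnil p)) /\
          projAlg_iso f].
Proof.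
exists (PG_regular_star P) => /=; split.
- by apply: PG_generated; apply: vertex_projection.
- by apply: PG_generated => p; have [] := vertex_projection p.
- by exists (@to_projection P); split=> //; apply: to_projection_iso.
Qed.
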